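(* Let $A$ be a bounded set in a real Banach space $X$. Then $$\operatorname{sm}(A)\le \tfrac12\operatorname{wbs}(A)\le \operatorname{wu}(A)\le 2\operatorname{sm}(A),$$ where $\operatorname{wu}(A)$ denotes the set quantity defined in the context.
   Context: For a bounded sequence $(x_k)$: $\operatorname{ca}(x_k)=\inf_{n}\sup\{\|x_k-x_l\|: k,l\ge n\}$, $\operatorname{cca}(x_k)=\operatorname{ca}(\frac1k\sum_{i=1}^k x_i)$, $\widetilde{\operatorname{cca}}(x_k)=\inf$ of $\operatorname{cca}$ over all subsequences; $\operatorname{wbs}(A)=\sup\{\widetilde{\operatorname{cca}}(x_k): (x_k)\subset A\text{ weakly convergent}\}$. For a sequence $(x_k)$ weakly converging to $x\in X$, $\operatorname{wu}(x_k)$ is the infimum of all $\varepsilon>0$ such that there is $n\in\mathbb N$ with $\#\{k\in\mathbb N: |x^*(x_k-x)|>\varepsilon\}\le n$ for every $x^*\in B_{X^*}$; $\widetilde{\operatorname{wu}}(x_k)=\inf$ of $\operatorname{wu}$ over all subsequences; and for a set, $\operatorname{wu}(A)=\sup\{\widetilde{\operatorname{wu}}(x_k): (x_k)\subset A\text{ weakly convergent}\}$. A bounded sequence $(x_k)$ generates an $\ell_1$-spreading model with $\delta>0$ if $\|\sum_{i\in F}\alpha_i x_i\|\ge\delta\sum_{i\in F}|\alpha_i|$ for every finite $F\subset\mathbb N$ with $\#F\le\min F$ and all real scalars $(\alpha_i)_{i\in F}$. Finally $\operatorname{sm}(A)=\sup\{\delta>0: \exists (x_k)\subset A,\ x_k\to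 x\text{ weakly},\ (x_k-x)\text{ generates an }\ell_1\text{-spreading model with }\delta\}$ (with $\sup\emptyset=0$). *)

(* Defs.v *)
From HB Require Import structures.
From mathcomp Require Import all_boot all_order all_algebra.
From mathcomp Require Import all_classical all_reals all_analysis.
Import Order.TTheory GRing.Theory Num.Theory.
Import numFieldNormedType.Exports.
Local Open Scope classical_set_scope.
Local Open Scope ring_scope.

Set Implicit Arguments.
Unset Strict Implicit.
Unset Printing Implicit Defensive.

Section Quantities.
Variables (R : realType) (X : normedModType R).

Definition dual_elem (f : X -> R) : Prop :=
  (forall x y, f (x + y) = f x + f y) /\
  (forall (a : R) x, f (a *: x) = a * f x) /\
  continuous f.

Definition dual_ball (f : X -> R) : Prop :=
  dual_elem f /\ (forall x, `|f x| <= `|x|).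

Definition weak_cvg (x : nat -> X) (y : X) : Prop :=
  forall f, dual_elem f -> (fun k => f (x k)) @ \oo --> f y.

Definition bounded_seq (x : nat -> X) : Prop :=
  exists M : R, forall k, `|x k| <= M.

Definition subseq_idx (phi : nat -> nat) : Prop :=
  forall n m, (n < m)%N -> (phi n < phi m)%N.

Definition ca (x : nat -> X) : \bar R :=
  ereal_inf [set ereal_sup [set (`|x k - x l|)%:E | k in [set k | (n <= k)%N]
                                                  & l in [set l | (n <= l)%N]]
            | n in [set: nat]].

(* Cesaro means: paper's (1/k) sum_{i=1}^k x_i, with 0-based indexing *)
Definition cesaro (x : nat -> X) (k : nat) : X :=
  (k.+1%:R)^-1 *: \sum_(i < k.+1) x i.

Definition cca (x : nat -> X) : \bar R := ca (cesaro x).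

Definition cca_tilde (x : nat -> X) : \bar R :=
  ereal_inf [set cca (x \o phi) | phi in subseq_idx].

(* sup with the convention sup of the empty set = 0 (all quantities are >= 0) *)
Definition sup0 (S : set (\bar R)) : \bar R := ereal_sup (S `|` [set 0%E]).

Definition wbs (A : set X) : \bar R :=
  sup0 [set cca_tilde x | x in [set x : nat -> X |
          (forall k, A (x k)) /\ exists y, weak_cvg x y]].

Definition wu_seq (x : nat -> X) (y : X) : \bar R :=
  ereal_inf [set e%:E | e in [set e : R | 0 < e /\
     exists n : nat, forall f, dual_ball f ->
        ([set k : nat | e < `|f (x k - y)|] #<= `I_n)%card]].

Definition wu_tilde (x : nat -> X) (y : X) : \bar R :=
  ereal_inf [set wu_seq (x \o phi) y | phi in subseq_idx].

Definition wu (A : set X) : \bar R :=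
  sup0 [set wu_tilde (fst p) (snd p) | p in [set p : (nat -> X) * X |
          (forall k, A (fst p k)) /\ weak_cvg (fst p) (snd p)]].

(* (y_k) generates an l_1 spreading model with constant delta.
   Paper index i >= 1 corresponds to our 0-based index i-1, so the
   condition #F <= min F reads  size F <= j.+1 for every j in F. *)
Definition l1_spreading (y : nat -> X) (delta : R) : Prop :=
  bounded_seq y /\
  forall (F : seq nat) (alpha : nat -> R), uniq F ->
    (forall j, j \in F -> (size F <= j.+1)%N) ->
    delta * (\sum_(i <- F) `|alpha i|) <= `| \sum_(i <- F) alpha i *: y i |.

Definition sm (A : set X) : \bar R :=
  sup0 [set d%:E | d in [set d : R | 0 < d /\
     exists (x : nat -> X) (y : X), (forall k, A (x k)) /\ weak_cvg x y /\
        l1_spreading (fun k => x k - y) d]].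

End Quantities.

(* Main.v *)
Require Import Defs.
From HB Require Import structures.
From mathcomp Require Import all_boot all_order all_algebra.
From mathcomp Require Import all_classical all_reals all_analysis.
From mathcomp Require Import finmap ring lra zify.
Import Order.TTheory GRing.Theory Num.Theory.
Import numFieldNormedType.Exports.
Local Open Scope classical_set_scope.

Set Implicit Arguments.
Unset Strict Implicit.
Unset Printing Implicit Defensive.

(** [sm <= wbs / 2]: along a sparse enough subsequence the l_1 lower estimate
    with constant delta applies to almost all terms of a difference of two
    Cesaro means of very different lengths, whose coefficients have l_1 norm
    close to 2.

    [wbs / 2 <= wu]: a norming functional of a Cesaro mean of [x_i - y] exceeds
    epsilon on at most n terms, so the means are eventually within almost epsilon
    of [y].

    [wu <= 2 sm]: if [c < wu_tilde x], every subsequence carries functionals of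
    the dual ball that are larger than [c], with one sign, on arbitrarily many
    terms. Weak* compactness and weak nullness of [x_i - y] provide, between
    these terms, others at which the functional is smaller than eta. Hence by
    Ramsey's theorem, after passing to a subsequence, for every Schreier set F
    and every G in F some functional is larger than [c] on G and smaller than eta
    on the rest of F. Taking for G the indices of the coefficients of one sign,
    the sign being the one that carries half of the l_1 norm, gives the constant
    [(c - eta) / 2]. *)

(** * Ramsey's theorem, and its diagonal form for Schreier sets *)

Section Ramsey.
Implicit Types (M : set nat) (s : seq nat).

Definition unbounded M := forall n, exists2 m, n < m & M m.

Definition increasing_in n M s :=
  [/\ size s = n, sorted ltn s & forall i, i \in s -> M i].

Lemma unbounded_color (c : nat -> bool) :
  exists b : bool, unbounded [set k | c k = b].
Proof.
apply: contrapT => /forallNP H.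
have /existsNP[n /forall2NP Hn] := H true.
have /existsNP[m /forall2NP Hm] := H false.
have := Hn (maxn n m).+1; have := Hm (maxn n m).+1.
rewrite /= !ltnS leq_maxl leq_maxr.
by case: (c _) => [_ []|[]].
Qed.

(** Induction on [n]: choosing points one by one and shrinking the set after each choice makes the
    colour of a list depend only on its first point; the pigeonhole principle then fixes this colour
    on an infinite set of points. *)
Lemma ramsey n (C : seq nat -> Prop) M : unbounded M ->
  exists M', [/\ M' `<=` M, unbounded M' & exists b : bool, forall s,
    increasing_in n M' s -> if b then C s else ~ C s].
Proof.
elim: n C M => [|n IH] C M Mu.
  exists M; split=> //; have [C0|C0] := pselect (C [::]).
    by exists true => s [/size0nil->].
  by exists false => s [/size0nil->].
pose T := {M | unbounded M}.
have step (W : T) : exists r : nat * T * bool,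
    [/\ sval W r.1.1, sval r.1.2 `<=` sval W `&` [set i | r.1.1 < i] &
     forall s, increasing_in n (sval r.1.2) s ->
       if r.2 then C (r.1.1 :: s) else ~ C (r.1.1 :: s)].
  case: W => W Wu /=; have [a _ Wa] := Wu 0.
  have Wau : unbounded (W `&` [set i | a < i]).
    move=> k; have [m km Wm] := Wu (maxn k a).
    by move: km; rewrite gtn_max => /andP[km am]; exists m.
  have [W' [W'W W'u [b bP]]] := IH (fun s => C (a :: s)) _ Wau.
  by exists (a, exist _ W' W'u, b).
have [F FP] := choice step.
pose W k : T := iter k (fun W => (F W).1.2) (exist _ M Mu).
pose a k := (F (W k)).1.1.
have aW k : sval (W k) (a k) by have [] := FP (W k).
have WS k : sval (W k.+1) `<=` sval (W k) `&` [set i | a k < i].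
  by have [] := FP (W k).
have WW k l : k <= l -> sval (W l) `<=` sval (W k).
  move=> /subnK <-; elim: (l - k) => // d IHd.
  by rewrite addSn => i /WS[/IHd].
have aWlt k l : k < l -> sval (W k.+1) (a l) by move=> kl; exact: (WW _ _ kl).
have a_lt k l : k < l -> a k < a l by move=> /aWlt/WS[].
have a_ge k : k <= a k.
  elim: k => // k IHk; exact: leq_ltn_trans IHk (a_lt _ _ (ltnSn k)).
have [b bu] := unbounded_color (fun k => (F (W k)).2).
exists (a @` [set k | (F (W k)).2 = b]); split.
- by move=> _ [k _ <-]; exact: (WW 0 k).
- move=> k; have [l kl lb] := bu k; exists (a l); last by exists l.
  exact: leq_trans kl (a_ge l).
- exists b => -[|i s] [] //= [sn] si sM.
  have [k /= kb ki] := sM i (mem_head _ _).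
  rewrite -ki -kb; have [_ _] := FP (W k); apply; split=> //.
    exact: path_sorted si.
  move=> j js; have [l _ lj] : (a @` [set k | (F (W k)).2 = b]) j.
    by apply: sM; rewrite inE js orbT.
  rewrite -lj; apply: aWlt; rewrite ltnNge; apply/negP => lk.
  have : i < j by move: si; rewrite (path_sortedE ltn_trans) => /andP[/allP/(_ _ js)].
  rewrite -ki -lj; move: lk; rewrite leq_eqVlt => /predU1P[->|/a_lt]; lia.
Qed.

Section Patterns.
Variable Q : seq nat -> seq bool -> Prop.
Hypothesis Q_dense : forall M (b : seq bool), unbounded M ->
  exists2 s, increasing_in (size b) M s & Q s b.

(** The colour [false] of Ramsey's theorem is impossible here, because [Q_dense] finds a good list
    in every infinite set; each pattern of [L] thus costs one passage to a subset. *)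
Lemma ramsey_patterns (L : seq (seq bool)) M : unbounded M ->
  exists M', [/\ M' `<=` M, unbounded M' &
    forall b s, b \in L -> increasing_in (size b) M' s -> Q s b].
Proof.
elim: L M => [|b L IH] M Mu; first by exists M; split.
have [M1 [M1M M1u M1Q]] := IH _ Mu.
have [M2 [M2M M2u [c cP]]] := ramsey (size b) (Q^~ b) M1u.
exists M2; split=> //; first exact: subset_trans M1M.
move=> b' s; rewrite inE => /predU1P[->{b'}|b'L] [ss sinc sM]; last first.
  by apply: M1Q => //; split=> // i /sM/M2M.
have [s0 s0M Qs0] := Q_dense b M2u.
by move: (cP s) (cP s0); case: c {cP} => [+ _|_ /(_ s0M)//]; apply; split.
Qed.

(* Diagonalising over the lengths n, where stage n makes all 2^n patterns on
   n-element sets good; the Schreier condition is what survives the diagonal. *)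
Lemma ramsey_schreier : exists2 phi : nat -> nat,
  (forall n m, n < m -> phi n < phi m) &
  forall s b, sorted ltn s -> (forall j, j \in s -> size s <= j.+1) ->
    size b = size s -> Q (map phi s) b.
Proof.
pose T := {M | unbounded M}.
have step (p : nat * T) : exists W : T, sval W `<=` sval p.2 /\
    forall b s, size b = p.1 -> increasing_in p.1 (sval W) s -> Q s b.
  case: p => n [M Mu] /=.
  have [M' [M'M M'u M'Q]] := ramsey_patterns (map val (enum {: n.-tuple bool})) Mu.
  exists (exist _ M' M'u); split=> // b s bn sM; apply: M'Q; last by rewrite bn.
  apply/mapP; exists (tcast bn (in_tuple b)); first by rewrite mem_enum.
  by rewrite /= val_tcast.
have [F FP] := choice step.
have uT : unbounded setT by move=> n; exists n.+1.
pose W := fix W k : T := if k is k'.+1 then F (k, W k') else exist _ setT uT.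
have WW k l : k <= l -> sval (W l) `<=` sval (W k).
  move=> /subnK <-; elim: (l - k) => // d IHd.
  by rewrite addSn => i /(FP (_, _)).1/IHd.
have WQ k b s : size b = k.+1 -> increasing_in k.+1 (sval (W k.+1)) s -> Q s b.
  by move=> bk sW; apply: (FP (k.+1, W k)).2.
have nextP (p : nat * nat) : exists m, p.2 < m /\ sval (W p.1) m.
  by have [m] := svalP (W p.1) p.2; exists m.
have [g gP] := choice nextP.
pose phi := fix phi k := if k is k'.+1 then g (k.+1, phi k') else g (1, 0).
have phiS k : phi k < phi k.+1 by exact: (gP (_, _)).1.
have phiW k : sval (W k.+1) (phi k).
  by case: k => [|k]; exact: (gP (_, _)).2.
have phi_lt n m : n < m -> phi n < phi m.
  elim: m => // m IHm; rewrite ltnS leq_eqVlt => /predU1P[->//|/IHm].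
  by move=> /ltn_trans; apply.
exists phi => // s b ss smin bs; case E : (size s) => [|n].
  have [s' [+ _ _]] := Q_dense b uT.
  by rewrite bs E => /size0nil->; rewrite (size0nil E).
apply: (@WQ n); first by rewrite bs.
split; first by rewrite size_map.
  rewrite sorted_map; apply: sub_sorted ss => i j; exact: phi_lt.
(* [phi j] lies in [W j.+1], and the Schreier condition [n.+1 <= j.+1] puts this set inside
   [W n.+1]. *)
move=> _ /mapP[j js ->]; apply: (WW _ j.+1) => //.
by rewrite -E; exact: smin.
Qed.

End Patterns.
End Ramsey.

Local Open Scope ring_scope.

(** * The Hahn-Banach theorem for sublinear functionals *)

Section HahnBanach.
Context {R : realType} {X : lmodType R}.
Implicit Types (p q : X -> R) (x y : X).

Definition sublinear p :=
  (forall x y, p (x + y) <= p x + p y) /\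
  (forall (t : R) x, 0 <= t -> p (t *: x) <= t * p x).

Lemma sublinear0 p : sublinear p -> p 0 = 0.
Proof.
case=> pD pZ; apply/eqP; rewrite eq_le; apply/andP; split.
  by have := pZ 0 0 (lexx _); rewrite scale0r mul0r.
by have := pD 0 0; rewrite addr0 -lerBlDr subrr.
Qed.

Lemma sublinearZ p (t : R) x : sublinear p -> 0 <= t -> p (t *: x) = t * p x.
Proof.
move=> sp; rewrite le_eqVlt => /predU1P[<-|t0].
  by rewrite scale0r mul0r sublinear0.
apply/eqP; rewrite eq_le; apply/andP; split; first by apply: sp.2; exact: ltW.
have := sp.2 t^-1 (t *: x); rewrite scalerA mulVf ?gt_eqF// scale1r.
by rewrite invr_ge0 ler_pdivlMl// => /(_ (ltW t0)).
Qed.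

Lemma sublinearN_le p x : sublinear p -> - p (- x) <= p x.
Proof.
by move=> sp; rewrite lerNl -subr_ge0 opprK -(sublinear0 sp) -(subrr x) addrC sp.1.
Qed.

(** For sublinear [p], this is the largest sublinear functional below [p] whose value at [- y] is at
    most [- p y]. *)
Definition tilt p y x : R :=
  inf [set p (x + t *: y) - t * p y | t in [set t : R | 0 <= t]].

Lemma tilt_le p y x (t : R) : sublinear p -> 0 <= t ->
  tilt p y x <= p (x + t *: y) - t * p y.
Proof.
move=> sp t0; apply: ge_inf; last by exists t.
exists (- p (- x)) => _ [s /= s0 <-].
rewrite -(sublinearZ _ sp s0) lerBrDr addrC lerBlDr.
by have := sp.1 (x + s *: y) (- x); rewrite addrAC subrr add0r.
Qed.

Lemma tilt_ge p y x (a : R) :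
  (forall t : R, 0 <= t -> a <= p (x + t *: y) - t * p y) -> a <= tilt p y x.
Proof.
move=> ha; apply: lb_le_inf; first by exists (p (x + 0 *: y) - 0 * p y), 0 => /=.
by move=> _ [t /= t0 <-]; exact: ha.
Qed.

Lemma sublinear_tilt p y : sublinear p -> sublinear (tilt p y).
Proof.
move=> sp; split=> [u v|t u].
  rewrite -lerBlDl; apply: tilt_ge => t t0; rewrite lerBlDl -lerBlDr.
  apply: tilt_ge => s s0; rewrite lerBlDr.
  have st0 : 0 <= s + t by exact: addr_ge0.
  apply: (le_trans (tilt_le y _ sp st0)).
  have := sp.1 (u + s *: y) (v + t *: y).
  by rewrite addrACA -scalerDl; lra.
rewrite le_eqVlt => /predU1P[<-|t0].
  rewrite scale0r mul0r (le_trans (tilt_le y _ sp (lexx 0)))//.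
  by rewrite scale0r addr0 mul0r subr0 sublinear0.
rewrite -ler_pdivrMl//; apply: tilt_ge => s s0; rewrite ler_pdivrMl//.
have ts0 : 0 <= t * s by rewrite mulr_ge0// ltW.
rewrite (le_trans (tilt_le y _ sp ts0))//.
by rewrite -scalerA -scalerDr (sublinearZ _ sp (ltW t0)) mulrBr mulrA.
Qed.

(* Zorn's lemma on the sublinear functionals themselves: a minimal one is
   linear, since it cannot be lowered by any of its tilts. *)
Lemma hahn_banach q : sublinear q -> exists p, [/\ forall x, p x <= q x,
  forall x y, p (x + y) = p x + p y & forall (t : R) x, p (t *: x) = t * p x].
Proof.
move=> sq; pose T := {p | sublinear p /\ forall x, p x <= q x}.
pose le_rev (p p' : T) := `[< forall x, sval p' x <= sval p x >].
have q0 : sublinear q /\ forall x, q x <= q x by split.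
have [||C totC|[p [sp pq]] pmin] := @ZL_preorder T (exist _ q q0) le_rev.
- by move=> p; apply/asboolP.
- move=> p1 p2 p3 /asboolP p12 /asboolP p23; apply/asboolP => x.
  exact: le_trans (p12 x).
- have [C0|/set0P[p0 Cp0]] := eqVneq C set0.
    by exists (exist _ q q0) => p; rewrite C0.
  (* The pointwise infimum bounds the chain; it is subadditive because, of any two members, the
     smaller one can be used at both points. *)
  pose m x := inf [set sval p x | p in C].
  have m_le (p : T) x : C p -> m x <= sval p x.
    move=> Cp; apply: ge_inf; last by exists p.
    exists (- q (- x)) => _ [[s [ss sq']] Cs <-] /=.
    by apply: le_trans (sublinearN_le _ ss); rewrite lerN2.
  have m_ge a x : (forall p : T, C p -> a <= sval p x) -> a <= m x.
    move=> ha; apply: lb_le_inf; first by exists (sval p0 x), p0.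
    by move=> _ [p Cp <-]; exact: ha.
  have sm : sublinear m.
    split=> [x y|t x].
      rewrite -lerBlDl; apply: (m_ge) => p Cp; rewrite lerBlDl -lerBlDr.
      apply: (m_ge) => p' Cp'; rewrite lerBlDr.
      have [/asboolP pp'|/asboolP pp'] := totC _ _ Cp Cp'.
        rewrite (le_trans (m_le _ _ Cp'))// (le_trans ((svalP p').1.1 _ _))//.
        by rewrite lerD2l.
      rewrite (le_trans (m_le _ _ Cp))// (le_trans ((svalP p).1.1 _ _))//.
      by rewrite lerD2r.
    rewrite le_eqVlt => /predU1P[<-|t0].
      rewrite scale0r mul0r (le_trans (m_le _ _ Cp0))//.
      by rewrite (sublinear0 (svalP p0).1).
    rewrite -ler_pdivrMl//; apply: (m_ge) => p Cp; rewrite ler_pdivrMl//.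
    by rewrite (le_trans (m_le _ _ Cp))// (svalP p).1.2// ltW.
  have mq : sublinear m /\ forall x, m x <= q x.
    by split=> // x; apply: (le_trans (m_le _ _ Cp0)); exact: (svalP p0).2.
  exists (exist _ m mq) => p Cp; apply/asboolP => x /=; exact: m_le.
- have pD x y : p (x + y) = p x + p y.
    apply/eqP; rewrite eq_le sp.1 /= -lerBrDr.
    have tq : sublinear (tilt p y) /\ forall u, tilt p y u <= q u.
      split=> [|u]; first exact: sublinear_tilt.
      apply: le_trans (pq u); have := tilt_le y u sp (lexx 0).
      by rewrite scale0r addr0 mul0r subr0.
    (* Minimality gives [p <= tilt p y], and the parameter [t = 1] in the infimum bounds
       [tilt p y x] by [p (x + y) - p y]. *)
    have /asboolP/(_ x)/= : le_rev (exist _ _ tq) (exist _ p (conj sp pq)).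
      apply: pmin; apply/asboolP => u /=.
      have := tilt_le y u sp (lexx 0).
      by rewrite scale0r addr0 mul0r subr0.
    move=> /le_trans; apply.
    by have := tilt_le y x sp ler01; rewrite scale1r mul1r.
  have pN x : p (- x) = - p x.
    by apply/eqP; rewrite -subr_eq0 opprK -pD addNr sublinear0.
  exists p; split=> // t x; have [t0|t0] := leP 0 t; first exact: sublinearZ.
  rewrite -[t]opprK scaleNr pN sublinearZ// ?mulNr// oppr_ge0; exact: ltW.
Qed.

End HahnBanach.

(** * Norming functionals *)

Section DualBall.
Context {R : realType} {X : normedModType R}.
Implicit Types (f : X -> R) (x y : X).

Lemma dual_ballP f : (forall x y, f (x + y) = f x + f y) ->
  (forall (t : R) x, f (t *: x) = t * f x) -> (forall x, `|f x| <= `|x|) ->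
  dual_ball f.
Proof.
move=> fD fZ f1; split=> //; split=> //; split=> // x.
apply/cvgrPdist_lt => e e0; near=> z.
have -> : f x - f z = f (x - z).
  by rewrite fD -[in RHS]scaleN1r fZ mulN1r.
apply: le_lt_trans (f1 _) _; near: z.
exact: cvgr_dist_lt.
Unshelve. all: by end_near. Qed.

(** Hahn-Banach is applied to the norm tilted at [x]: this stays below the norm, and it forces the
    value at [- x] down to minus the norm of [x]. *)
Lemma norming_functional x : exists2 f, dual_ball f & f x = `|x|.
Proof.
have sn : sublinear (fun y : X => `|y|).
  split=> [u v|t u t0]; first exact: ler_normD.
  by rewrite normrZ ger0_norm.
have [f [fle fD fZ]] := hahn_banach (sublinear_tilt x sn).
have fN y : f (- y) = - f y by rewrite -scaleN1r fZ mulN1r.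
have f1 y : f y <= `|y|.
  apply: (le_trans (fle y)); have := tilt_le x y sn (lexx 0).
  by rewrite scale0r addr0 mul0r subr0.
exists f.
  apply: dual_ballP => // y; rewrite ler_norml f1 andbT lerNl -fN.
  by rewrite -(normrN y) f1.
apply/eqP; rewrite eq_le f1 /= -lerN2 -fN (le_trans (fle _))//.
by have := tilt_le x (- x) sn ler01; rewrite scale1r addNr normr0 mul1r sub0r.
Qed.

End DualBall.

(** * Weak* compactness of the dual ball *)

Section WeakStar.
Context {R : realType} {X : normedModType R}.

(* Banach-Alaoglu: g is the weak* limit of f along an ultrafilter. *)
Lemma dual_ball_cluster (f : nat -> X -> R) : (forall n, dual_ball (f n)) ->
  exists2 g, dual_ball g & forall (x : X) (e : R),
    (\forall n \near \oo, e <= `|f n x|) -> e <= `|g x|.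
Proof.
move=> fB; have [U [UU ooU]] := @ultraFilterLemma _ (nbhs \oo) _.
have lim (x : X) : exists l : R, f n x @[n --> U] --> l.
  have [|l [_ lU]] := @segment_compact R (- `|x|) `|x| (f n x @[n --> U]) _.
    apply: (@filterE _ U) => n /=; rewrite in_itv /= -ler_norml.
    exact: (fB n).2.
  exists l => B lB; have [//|UnB] := in_ultra_setVsetC ((f^~ x) @^-1` B) UU.
  by have [r []] := lU (~` B) B UnB lB.
have [g gP] := choice lim.
have uniq_lim (h : nat -> R) (a b : R) : h @ U --> a -> h @ U --> b -> a = b.
  by move=> ha hb; exact: norm_cvg_unique ha hb.
exists g => [|x e ef]; last first.
  by apply: (cvgr_to_ge (cvg_norm (gP x))); exact: ooU.
apply: dual_ballP => [x y|t x|x].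
- apply: (uniq_lim (fun n => f n (x + y))); first exact: gP.
  under eq_fun do rewrite (fB _).1.1.
  by apply: cvgD; exact: gP.
- apply: (uniq_lim (fun n => f n (t *: x))); first exact: gP.
  under eq_fun do rewrite (fB _).1.2.1.
  by apply: cvgM; [exact: cvg_cst|exact: gP].
- apply: (cvgr_to_le (cvg_norm (gP x))).
  by apply: (@filterE _ U) => n; exact: (fB n).2.
Qed.

(** Were there no such [N], functionals that are at least [eta] in absolute value on ever longer
    pieces of [M] would have a weak* cluster point with this property on all of [M] from [m] on,
    against weak nullness. *)
Lemma weak_null_block (z : nat -> X) (eta : R) (M : set nat) (m : nat) :
  weak_cvg z 0 -> 0 < eta -> unbounded M ->
  exists N, forall f, dual_ball f ->
    exists i, [/\ (m <= i <= N)%N, M i & `|f (z i)| < eta].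
Proof.
move=> z0 eta0 Mu; apply: contrapT => /forallNP H.
have fex N : exists f, dual_ball f /\
    forall i, (m <= i <= N)%N -> M i -> eta <= `|f (z i)|.
  have /existsNP[f /not_implyP[fB /forallNP fN]] := H N.
  exists f; split=> // i mi Mi; rewrite leNgt; apply/negP => lt_eta.
  by apply: (fN i); split.
have [f fP] := choice fex.
have [g gB gP] := dual_ball_cluster (fun N => (fP N).1).
have [[gD [gZ _]] _] := gB.
have g0 : g 0 = 0 by rewrite -(scale0r 0) gZ mul0r.
have := z0 g gB.1; rewrite g0 => /cvgr0Pnorm_lt/(_ _ eta0)[k _ kP].
have [i ki Mi] := Mu (maxn k m).
have {}ki : (k <= i)%N /\ (m <= i)%N by lia.
have := kP i ki.1; apply/negP; rewrite -leNgt; apply: gP.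
exists i => // N /= iN; apply: (fP N).2 => //; lia.
Qed.

End WeakStar.

Lemma increasing_in_ncard (S : set nat) n :
  ~~ (S #<= `I_n)%card -> exists s, increasing_in n S s.
Proof.
move=> SI.
suff [s us [ns sS]] : exists2 s : seq nat,
    uniq s & (n <= size s)%N /\ forall i, i \in s -> S i.
  exists (take n (sort leq s)); split.
  - by rewrite size_take_min size_sort; lia.
  - apply: take_sorted; rewrite ltn_sorted_uniq_leq sort_uniq us /=.
    exact: (sort_sorted leq_total).
  - by move=> i /mem_take; rewrite mem_sort => /sS.
have [fS|/(@infinite_set_fset _ _ n)[B BS nB]] := pselect (finite_set S).
  have := fS => /finite_setP[m Sm]; exists (fset_set S); first exact: fset_uniq.
  split=> [|i]; last by rewrite in_fset_set// => /set_mem.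
  rewrite (card_fset_set Sm) leqNgt; apply: contra SI => mn.
  by rewrite (card_le_eql Sm) card_le_II ltnW.
by exists B; [exact: fset_uniq | split=> // i iB; exact: BS].
Qed.

(** * Large and small values of functionals, and the lower $\ell_1$ estimate *)

Section WuSpreading.
Context {R : realType} {X : normedModType R}.
Implicit Types (z x : nat -> X) (c eta : R).

Lemma dual_ballN (f : X -> R) : dual_ball f -> dual_ball (fun v => - f v).
Proof.
move=> [[fD [fZ _]] f1]; apply: dual_ballP => [u v|t u|u].
- by rewrite fD opprD.
- by rewrite fZ mulrN.
- by rewrite normrN.
Qed.

Lemma dual_ball_sum (f : X -> R) (F : seq nat) (a : nat -> R) z :
  dual_ball f -> f (\sum_(i <- F) a i *: z i) = \sum_(i <- F) a i * f (z i).
Proof.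
move=> [[fD [fZ _]] _]; have f0 : f 0 = 0 by rewrite -(scale0r 0) fZ mul0r.
elim: F => [|i F IH]; first by rewrite !big_nil.
by rewrite !big_cons fD fZ IH.
Qed.

Lemma wu_tilde_gt x y c (phi : nat -> nat) n :
  0 < c -> (c%:E < wu_tilde x y)%E -> subseq_idx phi ->
  exists2 f : X -> R, dual_ball f &
    exists s, increasing_in n [set k | c < `|f (x (phi k) - y)|] s.
Proof.
move=> c0 cwu phi_inc; apply: contrapT => H.
move: cwu; apply/negP; rewrite -leNgt.
apply: (@le_trans _ _ (wu_seq (x \o phi) y)).
  by apply: ereal_inf_lbound; exists phi.
apply: ereal_inf_lbound; exists c => //; split=> //; exists n => f fB.
apply: contrapT => /negP/increasing_in_ncard fs.
by apply: H; exists f.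
Qed.

(** Large values carry a sign, so that coefficients of one sign cannot cancel on the positions
    marked [true]. *)
Definition large_small z c eta (s : seq nat) (b : seq bool) :=
  exists2 f : X -> R, dual_ball f & forall t, (t < size b)%N ->
    if nth false b t then c < f (z (nth 0%N s t))
    else `|f (z (nth 0%N s t))| < eta.

(* Between any two terms of a sparse subsequence (g k) of M one inserts a block
   on which no functional of the dual ball stays above eta. A functional that is
   large at many g k then realises every pattern: use g k or a suitable element
   of the block following it. *)
Lemma large_small_dense z c eta (M : set nat) (b : seq bool) :
  weak_cvg z 0 -> 0 < eta ->
  (forall phi n, subseq_idx phi -> exists2 f : X -> R, dual_ball f &
    exists s, increasing_in n [set k | c < `|f (z (phi k))|] s) ->
  unbounded M ->
  exists2 s, increasing_in (size b) M s & large_small z c eta s b.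
Proof.
move=> z0 eta0 zc Mu.
have [N NP] := choice (fun m => @weak_null_block R X z eta M m.+1 z0 eta0 Mu).
have nextP m : exists k, (m < k)%N /\ M k by have [k] := Mu m; exists k.
have [next nextQ] := choice nextP.
(* Each term lies beyond the block attached to the previous one, so replacing terms by elements of
   their own blocks keeps the order. *)
pose g := fix g k := if k is k'.+1 then next (maxn (g k') (N (g k'))) else next 0%N.
have gM k : M (g k) by case: k => [|k]; exact: (nextQ _).2.
have gS k : (maxn (g k) (N (g k)) < g k.+1)%N by exact: (nextQ _).1.
have g_lt k l : (k < l)%N -> (maxn (g k) (N (g k)) < g l)%N.
  elim: l => // l IHl; rewrite ltnS leq_eqVlt => /predU1P[->|/IHl]; first exact: gS.
  by move=> /ltn_trans; apply; have := gS l; lia.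
have g_inc : subseq_idx g by move=> k l /g_lt; lia.
set n := size b.
(* Among [n + n] large values, [n] share a sign; if it is negative, the opposite functional is
   used. *)
have [f0 f0B [s0 [s0n s0inc s0P]]] := zc g (n + n)%N g_inc.
have [f fB [s [sn sinc sP] ]] : exists2 f : X -> R, dual_ball f &
    exists s, increasing_in n [set k | c < f (z (g k))] s.
  pose P (k : nat) := 0 <= f0 (z (g k)).
  have Pc : (n <= size [seq k <- s0 | P k])%N || (n <= size [seq k <- s0 | predC P k])%N.
    suff : (size [seq k <- s0 | P k] + size [seq k <- s0 | predC P k] = n + n)%N by lia.
    by rewrite !size_filter -s0n; exact: count_predC.
  case/orP: Pc => nP.
    exists f0 => //; exists (take n [seq k <- s0 | P k]); split.
    - by rewrite size_take_min; lia.
    - by apply: take_sorted; exact: (sorted_filter ltn_trans).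
    - move=> i /mem_take; rewrite mem_filter => /andP[Pi /s0P].
      by rewrite /= ger0_norm.
  exists (fun v => - f0 v); first exact: dual_ballN.
  exists (take n [seq k <- s0 | predC P k]); split.
  - by rewrite size_take_min; lia.
  - by apply: take_sorted; exact: (sorted_filter ltn_trans).
  - move=> i /mem_take; rewrite mem_filter /= /P -ltNge => /andP[Pi /s0P].
    by rewrite /= ltr0_norm.
(* The blocks were fixed before [f] was known; this is where the uniformity of [N] over the dual
   ball enters. *)
have [h hP] := choice (fun k => NP (g k) f fB).
pose e (p : bool * nat) := if p.1 then g p.2 else h p.2.
have e_nth t : (t < n)%N -> nth 0%N (map e (zip b s)) t =
    if nth false b t then g (nth 0%N s t) else h (nth 0%N s t).
  move=> tn; rewrite (nth_map (false, 0%N)) ?size_zip ?sn ?minnn//.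
  by rewrite nth_zip ?sn.
have szE : size (map e (zip b s)) = n by rewrite size_map size_zip sn minnn.
have e_bd p : (g p.2 <= e p <= maxn (g p.2) (N (g p.2)))%N.
  by rewrite /e; case: (p.1); have [] := hP p.2; lia.
exists (map e (zip b s)); last first.
  exists f => // t tn; rewrite e_nth//.
  have ts : nth 0%N s t \in s by rewrite mem_nth// sn.
  by case: (nth false b t); [exact: sP | have [] := hP (nth 0%N s t)].
split=> //.
  apply/(sortedP 0%N) => t; rewrite szE => tn.
  have tn' := ltnW tn.
  rewrite !(nth_map (false, 0%N)) ?size_zip ?sn ?minnn// !nth_zip ?sn//.
  have /andP[_ le1] := e_bd (nth false b t, nth 0%N s t).
  have /andP[le2 _] := e_bd (nth false b t.+1, nth 0%N s t.+1).
  apply: (leq_ltn_trans le1); apply: leq_trans le2; apply: g_lt => /=.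
  by move/(sortedP 0%N): sinc; apply; rewrite sn.
by move=> _ /mapP[p _ ->]; rewrite /e; case: (p.1) => //; have [] := hP p.2.
Qed.

(** Let [p] and [q] be the $\ell_1$ norms of the coefficients of the heavier and of the lighter
    sign. A functional adapted to these signs yields at least [c * p - eta * q], which exceeds
    [(c - eta) / 2 * (p + q)] by [(c + eta) / 2 * (p - q)]. *)
Lemma large_small_l1_le z c eta (F : seq nat) (a : nat -> R) :
  0 < eta < c ->
  (forall b, size b = size F -> large_small z c eta F b) ->
  (c - eta) / 2 * \sum_(i <- F) `|a i| <= `|\sum_(i <- F) a i *: z i|.
Proof.
move=> /andP[eta0 etac] FP.
suff key (u : nat -> R) (P : pred nat) : (forall i, if P i then 0 <= u i else u i <= 0) ->
    \sum_(i <- F | ~~ P i) `|u i| <= \sum_(i <- F | P i) `|u i| ->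
    (c - eta) / 2 * \sum_(i <- F) `|u i| <= `|\sum_(i <- F) u i *: z i|.
  have aP i : if 0 <= a i then 0 <= a i else a i <= 0.
    by case: ifPn => //; rewrite -ltNge => /ltW.
  have [/(key _ _ aP)//|/ltW le] :=
    leP (\sum_(i <- F | ~~ (0 <= a i)) `|a i|) (\sum_(i <- F | 0 <= a i) `|a i|).
  have := key (fun i => - a i) (fun i => ~~ (0 <= a i)).
  have -> : \sum_(i <- F) - a i *: z i = - \sum_(i <- F) a i *: z i.
    by rewrite -sumrN; apply: eq_bigr => i _; rewrite scaleNr.
  have normE (Q : pred nat) : \sum_(i <- F | Q i) `|- a i| = \sum_(i <- F | Q i) `|a i|.
    by apply: eq_bigr => i _; rewrite normrN.
  rewrite !normE normrN; apply => [i|].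
    by rewrite oppr_ge0 oppr_le0; move: (aP i); case: (0 <= a i).
  by under eq_bigl do rewrite negbK.
move=> uP half.
have [f fB fP] := FP (map P F) (size_map _ _).
apply: le_trans (fB.2 _); apply: le_trans (ler_norm _).
rewrite (dual_ball_sum _ _ _ fB) (bigID P) /=.
rewrite [leRHS](bigID P) /=.
have fF i : i \in F -> if P i then c < f (z i) else `|f (z i)| < eta.
  move=> /(nthP 0%N)[t tF <-]; have := fP t; rewrite size_map => /(_ tF).
  by rewrite (nth_map 0%N).
have pos : c * \sum_(i <- F | P i) `|u i| <= \sum_(i <- F | P i) u i * f (z i).
  rewrite big_distrr /= !(big_seq_cond P).
  apply: ler_sum => i /andP[/fF + ui]; rewrite ui => /ltW cf.
  have := uP i; rewrite ui => u0.
  by rewrite ger0_norm// mulrC ler_wpM2l.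
have neg : - (eta * \sum_(i <- F | ~~ (P i)) `|u i|) <=
    \sum_(i <- F | ~~ (P i)) u i * f (z i).
  rewrite big_distrr /= -sumrN !(big_seq_cond (fun i => ~~ (P i))).
  apply: ler_sum => i /andP[/fF + /negbTE ui]; rewrite ui => /ltW cf.
  rewrite lerNl -mulrN (le_trans (ler_norm _))// normrM normrN mulrC.
  by rewrite ler_wpM2r.
move: pos neg half; set p := \sum_(i <- F | P i) `|u i|.
set q := \sum_(i <- F | ~~ (P i)) `|u i|.
have p0 : 0 <= p by apply: sumr_ge0.
have q0 : 0 <= q by apply: sumr_ge0.
nra.
Qed.

End WuSpreading.

Section Sup0.
Context {R : realType}.
Implicit Types (S : set (\bar R)).

Lemma sup0_ge0 S : (0 <= Defs.sup0 S)%E.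
Proof. by apply: ereal_sup_ubound; right. Qed.

Lemma sup0_ubound S u : S u -> (u <= Defs.sup0 S)%E.
Proof. by move=> Su; apply: ereal_sup_ubound; left. Qed.

Lemma sup0_le S u : (0 <= u)%E -> (forall v, S v -> (v <= u)%E) -> (Defs.sup0 S <= u)%E.
Proof. by move=> u0 uS; apply: ge_ereal_sup => v [/uS//|->]. Qed.

End Sup0.

(** * The bounds [wu <= 2 sm] and [wbs / 2 <= wu] *)

Section Sequences.
Context {R : realType} {X : normedModType R}.
Implicit Types (x : nat -> X) (y : X) (A : set X).

Lemma bounded_set_norm A : bounded_set A -> exists K : R, forall v, A v -> `|v| <= K.
Proof.
move=> [K [_ KA]]; exists (K + 1) => v Av.
by apply: KA => //; rewrite ltrDl.
Qed.

Lemma dual_elemB (f : X -> R) u v : dual_elem f -> f (u - v) = f u - f v.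
Proof. by move=> [fD [fZ _]]; rewrite fD -[- v]scaleN1r fZ mulN1r. Qed.

Lemma weak_cvgB x y : weak_cvg x y -> weak_cvg (fun k => x k - y) 0.
Proof.
move=> xy f fX; have := xy f fX; rewrite -(subrr y) (dual_elemB _ _ fX) => fxy.
under eq_fun do rewrite (dual_elemB _ _ fX).
by apply: cvgB => //; exact: cvg_cst.
Qed.

Lemma subseq_idx_ge phi k : subseq_idx phi -> (k <= phi k)%N.
Proof.
move=> phi_inc; elim: k => // k IHk.
exact: leq_ltn_trans IHk (phi_inc _ _ (ltnSn k)).
Qed.

Lemma weak_cvg_subseq x y phi : subseq_idx phi -> weak_cvg x y -> weak_cvg (x \o phi) y.
Proof.
move=> phi_inc xy f fX; apply: (cvg_comp phi (fun k => f (x k)) _ (xy f fX)).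
move=> B [N _ NB]; exists N => // k /= Nk; apply: NB => /=.
exact: leq_trans Nk (subseq_idx_ge k phi_inc).
Qed.

Lemma wu_le_sm A : bounded_set A -> (wu A <= 2%:E * sm A)%E.
Proof.
move=> /bounded_set_norm[K KA].
apply: sup0_le; first by rewrite mule_ge0// sup0_ge0.
move=> _ [[x y] /= [xA xy] <-]; rewrite leNgt; apply/negP.
have sm_ub d : 0 < d -> (exists (x : nat -> X) y, (forall k, A (x k)) /\
    weak_cvg x y /\ l1_spreading (fun k => x k - y) d) -> (d%:E <= sm A)%E.
  by move=> d0 dP; apply: sup0_ubound; exists d.
have sm0 : (0 <= sm A)%E by exact: sup0_ge0.
case E : (sm A) sm0 sm_ub => [r| |] // r0 sm_ub; last by rewrite gt0_muley ?lte_fin// ltNge leey.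
rewrite lee_fin in r0; rewrite -EFinM => rwu.
have [c rc cwu] : exists2 c : R, 2 * r < c & (c%:E < wu_tilde x y)%E.
  case: (wu_tilde x y) rwu => [w| |] //.
    by rewrite lte_fin => rw; exists ((2 * r + w) / 2); rewrite ?lte_fin; lra.
  by exists (2 * r + 1); rewrite ?ltry//; lra.
(* With this choice the constant [(c - eta) / 2] equals [(c + 2 * r) / 4], which still exceeds
   [r]. *)
pose eta := (c - 2 * r) / 2; have eta0 : 0 < eta by rewrite /eta; lra.
have etac : 0 < eta < c by rewrite eta0 /eta; lra.
have c0 : 0 < c by lra.
pose z k := x k - y.
have [phi phi_inc phiP] := ramsey_schreier (fun M b => @large_small_dense R X z c eta M b
  (weak_cvgB xy) eta0 (fun phi n => wu_tilde_gt n c0 cwu)).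
have := sm_ub ((c - eta) / 2); rewrite lee_fin => H.
suff : (c - eta) / 2 <= r by rewrite /eta; lra.
apply: H; first by rewrite /eta; lra.
exists (x \o phi), y; split=> [k|]; first exact: xA.
split; first exact: weak_cvg_subseq.
split.
  exists (K + `|y|) => k; apply: (le_trans (ler_normB _ _)).
  by rewrite lerD2r; exact/KA/xA.
move=> F a uF FP.
have pF : perm_eq F (sort leq F) by rewrite perm_sym perm_sort.
rewrite !(perm_big _ pF) /=.
apply: (large_small_l1_le (z := z \o phi) _ etac) => b bF.
have [||f fB fP] := phiP (sort leq F) b _ _ bF.
- by rewrite ltn_sorted_uniq_leq sort_uniq uF; exact: (sort_sorted leq_total).
- by move=> j; rewrite mem_sort size_sort => /FP.
exists f => // t tb; have := fP t tb.
by rewrite (nth_map 0%N)// -bF.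
Qed.

Lemma cesaroB x y k :
  Defs.cesaro x k - y = \sum_(i <- index_iota 0 k.+1) k.+1%:R^-1 *: (x i - y).
Proof.
rewrite -scaler_sumr sumrB big_mkord scalerBr; congr (_ - _).
rewrite big_const_seq count_predT size_iota subn0 iter_addr_0.
by rewrite -(scaler_nat _ y) scalerA mulVf ?pnatr_eq0// scale1r.
Qed.

Lemma size_card_le (S : set nat) n (s : seq nat) : (S #<= `I_n)%card ->
  uniq s -> (forall i, i \in s -> S i) -> (size s <= n)%N.
Proof.
move=> Sn us sS; apply: leq_trans (geq_card_fset_set Sn).
have fS : finite_set S by apply: card_le_finite Sn _; exact: finite_II.
by apply: uniq_leq_size => // i /sS Si; rewrite in_fset_set//; exact: mem_set.
Qed.

(** For a functional norming the mean minus [y], the values not above [e] contribute at most [e] to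
    the average, and the at most [n] others contribute at most [K] each before division by
    [k.+1]. *)
Lemma cesaro_dist_le x y (e K : R) n k : 0 < e -> (forall i, `|x i - y| <= K) ->
  (forall f : X -> R, dual_ball f ->
     ([set i | e < `|f (x i - y)|] #<= `I_n)%card) ->
  `|Defs.cesaro x k - y| <= e + K * n%:R / k.+1%:R.
Proof.
move=> e0 xK xn; have [f fB <-] := norming_functional (Defs.cesaro x k - y).
have K0 : 0 <= K by apply: le_trans (xK 0%N).
rewrite cesaroB (dual_ball_sum _ _ _ fB) -mulr_sumr.
rewrite -ler_pdivlMl ?invr_gt0 ?ltr0n// invrK mulrDr mulrCA mulfV ?pnatr_eq0// mulr1.
set P := fun i => e < `|f (x i - y)|.
rewrite (bigID P) /= addrC lerD//.
  apply: (@le_trans _ _ (\sum_(0 <= i < k.+1 | ~~ P i) e)).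
    by apply: ler_sum => i; rewrite /P -leNgt => /(le_trans (ler_norm _)).
  apply: (@le_trans _ _ (\sum_(0 <= i < k.+1) e)).
    by rewrite [leRHS](bigID P) /= lerDr sumr_ge0// => i _; exact: ltW.
  by rewrite sumr_const_nat subn0 mulr_natl.
apply: (@le_trans _ _ (\sum_(0 <= i < k.+1 | P i) K)).
  apply: ler_sum => i _; apply: (le_trans (ler_norm _)).
  exact: (le_trans (fB.2 _)).
rewrite -big_filter big_const_seq count_predT iter_addr_0 -(mulr_natr K) ler_wpM2l// ler_nat.
apply: size_card_le (xn f fB) _ _; first by rewrite filter_uniq// iota_uniq.
by move=> i; rewrite mem_filter => /andP[].
Qed.

(** Two late means both lie within almost [e] of [y], whence the factor 2. *)
Lemma cca_le x y (e K : R) n : 0 < e -> (forall i, `|x i - y| <= K) ->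
  (forall f : X -> R, dual_ball f ->
     ([set i | e < `|f (x i - y)|] #<= `I_n)%card) ->
  (cca x <= (2 * e)%:E)%E.
Proof.
move=> e0 xK xn; have K0 : 0 <= K by apply: le_trans (xK 0%N).
apply/lee_addgt0Pr => d d0.
have d20 : 0 < d / 2 by lra.
have [N NP] : exists N, forall k, (N <= k)%N -> K * n%:R / k.+1%:R <= d / 2.
  exists (Num.truncn (K * n%:R / (d / 2))) => k Nk.
  rewrite ler_pdivrMr ?ltr0n// -ler_pdivrMl// [_^-1 * _]mulrC.
  by apply: (le_trans (ltW (truncnS_gt _))); rewrite ler_nat.
apply: (@le_trans _ _ (ereal_sup [set (`|Defs.cesaro x k - Defs.cesaro x l|)%:E
    | k in [set k | (N <= k)%N] & l in [set l | (N <= l)%N]])).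
  by apply: ereal_inf_lbound; exists N.
apply: ge_ereal_sup => _ [k /= Nk [l /= Nl <-]]; rewrite lee_fin.
have := cesaro_dist_le k e0 xK xn; have := cesaro_dist_le l e0 xK xn.
have := NP _ Nk; have := NP _ Nl.
have -> : Defs.cesaro x k - Defs.cesaro x l = (Defs.cesaro x k - y) - (Defs.cesaro x l - y).
  by rewrite opprB addrA subrK.
have := ler_normB (Defs.cesaro x k - y) (Defs.cesaro x l - y).
move: (K * _ / k.+1%:R) (K * _ / l.+1%:R) => a b; lra.
Qed.

Lemma wbs_le_wu A : bounded_set A -> ((2^-1)%:E * wbs A <= wu A)%E.
Proof.
move=> /bounded_set_norm[K KA]; rewrite lee_pdivrMl//.
apply: sup0_le; first by rewrite mule_ge0// sup0_ge0.
move=> _ [x /= [xA [y xy]] <-]; rewrite -lee_pdivrMl//.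
apply: (@le_trans _ _ (wu_tilde x y)); last by apply: sup0_ubound; exists (x, y).
apply: le_ereal_inf_tmp => _ [phi phi_inc <-].
apply: le_ereal_inf_tmp => _ [e /= [e0 [n nP]] <-]; rewrite lee_pdivrMl// -EFinM.
apply: (@le_trans _ _ (cca (x \o phi))); first by apply: ereal_inf_lbound; exists phi.
apply: (cca_le (K := K + `|y|) e0 _ nP) => i.
by apply: (le_trans (ler_normB _ _)); rewrite lerD2r; exact/KA/xA.
Qed.

End Sequences.

(** * The bound [sm <= wbs / 2] *)

Section SpreadingCesaro.
Context {R : realType} {X : normedModType R}.
Implicit Types (x v : nat -> X) (y : X) (A : set X).

Lemma cesaroBB x y k l : (k <= l)%N -> Defs.cesaro x k - Defs.cesaro x l =
  \sum_(0 <= i < l.+1)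
    ((i <= k)%:R * k.+1%:R^-1 - l.+1%:R^-1) *: (x i - y).
Proof.
move=> kl.
have -> : Defs.cesaro x k - Defs.cesaro x l = (Defs.cesaro x k - y) - (Defs.cesaro x l - y).
  by rewrite opprB addrA subrK.
rewrite !(cesaroB x y); under [RHS]eq_bigr do rewrite scalerBl.
rewrite sumrB; congr (_ - _).
rewrite [RHS](big_cat_nat _ (n := k.+1))//= -[LHS]addr0; congr (_ + _).
  by apply: eq_big_nat => i /andP[_ ik]; rewrite -ltnS ik mul1r.
rewrite big_nat_cond big1// => i /andP[/andP[ki _] _].
by rewrite leqNgt ki mul0r scale0r.
Qed.

(** All coefficients of the difference together have $\ell_1$ norm [2 - 2 * (k.+1 / l.+1)]. The
    terms before [j], which the lower estimate does not reach, cost at most [K * (j / k.+1)] in norm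
    and [delta * (j / k.+1)] in lost coefficients. *)
Lemma cesaro_l1_ge x y (delta K : R) j k l : 0 <= delta ->
  (j <= k)%N -> (k <= l)%N -> (forall i, `|x i - y| <= K) ->
  (forall a : nat -> R, delta * \sum_(j <= i < l.+1) `|a i| <=
     `|\sum_(j <= i < l.+1) a i *: (x i - y)|) ->
  delta * (2 - 2 * (k.+1%:R / l.+1%:R)) - (delta + K) * (j%:R / k.+1%:R)
    <= `|Defs.cesaro x k - Defs.cesaro x l|.
Proof.
move=> d0 jk kl xK xd; rewrite (cesaroBB x y kl).
set a := fun i : nat => (i <= k)%:R * k.+1%:R^-1 - l.+1%:R^-1 : R.
have K0 : 0 <= K by apply: le_trans (xK 0%N).
have k0 : 0 < k.+1%:R :> R by rewrite ltr0n.
have l0 : 0 < l.+1%:R :> R by rewrite ltr0n.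
have lk : l.+1%:R^-1 <= k.+1%:R^-1 :> R by rewrite lef_pV2 ?posrE// ler_nat.
have l0' : 0 < l.+1%:R^-1 :> R by rewrite invr_gt0.
have head : `|\sum_(0 <= i < j) a i *: (x i - y)| <= K * (j%:R / k.+1%:R).
  apply: (le_trans (ler_norm_sum _ _ _)).
  apply: (@le_trans _ _ (\sum_(0 <= i < j) K / k.+1%:R)); last first.
    by rewrite sumr_const_nat subn0 -(mulr_natr (K / _)) mulrAC mulrA.
  rewrite !big_nat; apply: ler_sum => i /andP[_ ij]; rewrite normrZ mulrC.
  apply: ler_pM => //; rewrite /a (leq_trans (ltnW ij) jk) mul1r.
  by rewrite ger0_norm ?subr_ge0// gerBl ltW.
have tail : \sum_(j <= i < l.+1) `|a i| =
    2 - 2 * (k.+1%:R / l.+1%:R) - j%:R * (k.+1%:R^-1 - l.+1%:R^-1).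
  have jk' : (j <= k.+1)%N by exact: leqW.
  rewrite (big_cat_nat _ (n := k.+1))//=.
  have -> : \sum_(j <= i < k.+1) `|a i| = (k.+1 - j)%:R * (k.+1%:R^-1 - l.+1%:R^-1).
    rewrite mulr_natl -sumr_const_nat; apply: eq_big_nat => i /andP[_ ik].
    by rewrite /a -ltnS ik mul1r ger0_norm ?subr_ge0.
  have -> : \sum_(k.+1 <= i < l.+1) `|a i| = (l.+1 - k.+1)%:R * l.+1%:R^-1.
    rewrite mulr_natl -sumr_const_nat; apply: eq_big_nat => i /andP[ki _].
    by rewrite /a leqNgt ki mul0r sub0r normrN ger0_norm// ltW.
  by rewrite !natrB//; field; rewrite !gt_eqF.
rewrite -[X in `|X|]/(\sum_(0 <= i < l.+1) a i *: (x i - y)).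
rewrite (big_cat_nat _ (n := j))//=; last by lia.
set u := \sum_(0 <= i < j) _ in head *; set w := \sum_(j <= i < l.+1) a i *: _.
have := xd a; rewrite tail -/w => wd.
have uw : `|w| - `|u| <= `|u + w| by rewrite [u + w]addrC; exact: lerB_normD.
have jl : 0 <= delta * (j%:R * l.+1%:R^-1) by rewrite !mulr_ge0// ltW.
move: wd jl head uw; rewrite mulrBr.
have -> : j%:R * (k.+1%:R^-1 - l.+1%:R^-1) = j%:R / k.+1%:R - j%:R * l.+1%:R^-1 :> R.
  by rewrite mulrBr.
move: (j%:R / k.+1%:R) (j%:R * l.+1%:R^-1) (k.+1%:R / l.+1%:R) => p q r; lra.
Qed.

Lemma l1_spreading_sparse v (delta : R) (theta : nat -> nat) F (a : nat -> R) :
  l1_spreading v delta -> subseq_idx theta -> uniq F ->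
  (forall j, j \in F -> (size F <= (theta j).+1)%N) ->
  delta * \sum_(i <- F) `|a i| <= `|\sum_(i <- F) a i *: v (theta i)|.
Proof.
move=> [_ vd] theta_inc uF FP.
have theta_inj : injective theta.
  move=> i j ij; have [/theta_inc|/theta_inc|//] := ltngtP i j; lia.
(* [l1_spreading] indexes coefficients by the terms of [v], so [a] is transported by a left inverse
   of [theta], with the arbitrary value 0 off its range. *)
have inv j : exists i, forall i', theta i' = j -> i' = i.
  have [[i <-]|ni] := pselect (exists i, theta i = j); first by exists i => i' /theta_inj.
  by exists 0%N => i' ij; case: ni; exists i'.
have [g gP] := choice inv.
have thetaK i : g (theta i) = i by rewrite -(gP (theta i) i).
have := vd (map theta F) (a \o g); rewrite !big_map /=.
under eq_bigr do rewrite thetaK.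
under [X in _ -> _ -> _ <= `|X|]eq_bigr do rewrite thetaK.
apply; first by rewrite map_inj_uniq.
by move=> _ /mapP[j jF ->]; rewrite size_map; exact: FP.
Qed.

Lemma sm_le_wbs A : (sm A <= (2^-1)%:E * wbs A)%E.
Proof.
rewrite lee_pdivlMl//.
suff H d : 0 < d -> (exists x y, (forall k, A (x k)) /\ weak_cvg x y /\
    l1_spreading (fun k => x k - y) d) -> ((2 * d)%:E <= wbs A)%E.
  rewrite -lee_pdivlMl//; apply: sup0_le.
    by rewrite mule_ge0 ?lee_fin ?invr_ge0//; exact: sup0_ge0.
  by move=> _ [d [d0 dP] <-]; rewrite lee_pdivlMl// -EFinM; exact: H.
move=> d0 [x [y [xA [xy sp]]]].
(* n |-> n ^ 4 makes the estimate available on [j, j ^ 4[; it is applied to the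
   Cesaro means of lengths j ^ 2 and j ^ 4. *)
pose psi n := (n ^ 4)%N.
have psi_inc : subseq_idx psi by move=> n m nm; rewrite ltn_exp2r.
apply: (@le_trans _ _ (cca_tilde (x \o psi))); last first.
  apply: sup0_ubound; exists (x \o psi) => //; split=> [k|]; first exact: xA.
  by exists y; exact: weak_cvg_subseq.
apply: le_ereal_inf_tmp => _ [phi phi_inc <-].
have [[K xK] _] := sp.
apply/lee_subgt0Pr => e e0; apply: le_ereal_inf_tmp => _ [n _ <-].
have K0 : 0 <= K by apply: le_trans (xK 0%N).
(* [C] collects the errors: for [t = 1 / j] one has [t ^ 2 <= t], so
   [d * (2 - 2 * t ^ 2) - (d + K) * t] is at least [2 * d - C * t]. *)
pose C := 3 * d + K; have C0 : 0 < C by rewrite /C; lra.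
pose j := (maxn n (Num.truncn (C / e))).+2.
have j0 : 0 < j%:R :> R by rewrite ltr0n.
have jC : C / j%:R <= e.
  rewrite ler_pdivrMr// -ler_pdivrMl// [_^-1 * _]mulrC (le_trans (ltW (truncnS_gt _)))//.
  by rewrite ler_nat /j ltnS leqW// leq_maxr.
(* Predecessors appear because [cesaro] at index [k] averages [k.+1] terms. *)
have jk : (j <= (j ^ 2).-1)%N by rewrite /j; nia.
have kl : ((j ^ 2).-1 <= (j ^ 4).-1)%N by rewrite /j; nia.
have nk : (n <= (j ^ 2).-1)%N by apply: leq_trans jk; rewrite /j; lia.
apply: le_ereal_sup_tmp.
exists (`|Defs.cesaro (x \o psi \o phi) (j ^ 2).-1 - Defs.cesaro (x \o psi \o phi) (j ^ 4).-1|)%:E.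
  by exists (j ^ 2).-1 => //=; exists (j ^ 4).-1 => //=; exact: leq_trans kl.
have theta_inc : subseq_idx (psi \o phi) by move=> a b ab; apply/psi_inc/phi_inc.
rewrite -EFinB lee_fin.
have j2E : (j ^ 2).-1.+1 = (j ^ 2)%N by rewrite prednK// expn_gt0.
have j4E : (j ^ 4).-1.+1 = (j ^ 4)%N by rewrite prednK// expn_gt0.
have := @cesaro_l1_ge (x \o psi \o phi) y d K j (j ^ 2).-1 (j ^ 4).-1 (ltW d0) jk kl.
rewrite j2E j4E => ge; apply: le_trans (ge _ _); last 2 first.
- by move=> i; exact: xK.
- move=> a; apply: (l1_spreading_sparse (v := fun k => x k - y)) sp theta_inc _ _.
    exact: iota_uniq.
  move=> i; rewrite mem_index_iota size_iota => /andP[ji _].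
  (* Since [phi i >= i >= j], the bound [psi (phi i) >= j ^ 4] survives any further subsequence
     [phi]. *)
  apply: (@leq_trans (j ^ 4)); first exact: leq_subr.
  apply: leqW; rewrite leq_exp2r//; apply: leq_trans ji _.
  exact: subseq_idx_ge.
have -> : (j ^ 2)%:R / (j ^ 4)%:R = j%:R^-1 ^+ 2 :> R.
  by rewrite !natrX; field; rewrite gt_eqF.
have -> : j%:R / (j ^ 2)%:R = j%:R^-1 :> R.
  by rewrite !natrX; field; rewrite gt_eqF.
have t0 : 0 < j%:R^-1 :> R by rewrite invr_gt0.
have t1 : j%:R^-1 <= 1 / 2 :> R.
  by rewrite mul1r lef_pV2 ?posrE// ler_nat.
move: jC; rewrite /C; move: (j%:R^-1) t0 t1 => t t0 t1 te.
have : d * t ^+ 2 <= d * t by rewrite ler_pM2l// expr2 ger_pMr//; lra.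
lra.
Qed.

End SpreadingCesaro.

Theorem theorem4p1 (R : realType) (X : completeNormedModType R) (A : set X)
  (hA : bounded_set A) :
  (sm A <= (2^-1)%:E * wbs A)%E /\
  ((2^-1)%:E * wbs A <= wu A)%E /\
  (wu A <= 2%:E * sm A)%E.
Proof.
split; first exact: sm_le_wbs.
by split; [exact: wbs_le_wu | exact: wu_le_sm].
Qed.
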